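(* Let $\mathcal{H}$ be a Hilbert space, let $n\ge1$, let $\delta$ be a real number, and suppose $\mathsf{P}_1,\dots,\mathsf{P}_n$ are orthogonal projections with respect to the inner product of $\mathcal{H}$ satisfying $$\left\|\frac1n\sum_{i=1}^n\mathsf{P}_i\right\|_{\mathsf{op}}\le 1-\delta.$$ Let $\mathsf{P}_{i_L}\cdots\mathsf{P}_{i_1}$ (with $i_1,\dots,i_L\in\{1,\dots,n\}$) be any product of these projections satisfying the following condition: for each $j\in\{1,\dots,n\}$ there exists a minimal index $k_j\le L$ with $i_{k_j}=j$, and these indices satisfy $$1=k_1\le k_2\le\cdots\le k_n=L.$$ Then $$\|\mathsf{P}_{i_L}\cdots\mathsf{P}_{i_1}\|_{\mathsf{op}}^2\le 1-\frac{n\delta}{8\sum_{j=1}^n k_j}.$$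
   Context: For a bounded linear operator $\mathsf{A}:\mathcal{H}\to\mathcal{H}$, $\|\mathsf{A}\|_{\mathsf{op}}=\sup_{f\in\mathcal{H},\,f\neq0}\|\mathsf{A}f\|/\|f\|$, where $\|\cdot\|$ is the norm induced by the inner product. The index $k_j$ is the position of the first occurrence of $j$ in the sequence $i_1,i_2,\dots,i_L$. *)

(* Defs.v *)
From HB Require Import structures.
From mathcomp Require Import all_boot all_order all_algebra sesquilinear.
From mathcomp Require Import complex.
From mathcomp Require Import all_classical all_reals all_analysis.

Set Implicit Arguments.
Unset Strict Implicit.
Unset Printing Implicit Defensive.
Import Order.TTheory GRing.Theory Num.Theory.
Import numFieldNormedType.Exports.
Local Open Scope classical_set_scope.
Local Open Scope ring_scope.

(* Hilbert spaces may be real or complex: everything below is parameterised by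
   the scalar field. *)
Variant scalar_kind := RealScalars | ComplexScalars.

Definition scalar (R : realType) (k : scalar_kind) : numFieldType :=
  match k with RealScalars => R | ComplexScalars => R[i] end.

Definition sconj (R : realType) (k : scalar_kind) :
    {rmorphism scalar R k -> scalar R k} :=
  match k with
  | RealScalars => idfun : {rmorphism R -> R}
  | ComplexScalars => (@conjc R) : {rmorphism R[i] -> R[i]}
  end.

Definition sre (R : realType) (k : scalar_kind) : scalar R k -> R :=
  match k with RealScalars => id | ComplexScalars => @complex.Re R end.

(* {dot _ for _} is linear in its first argument, conjugate-linear in the
   second, and positive definite. *)
Record hilbertSpace (R : realType) (k : scalar_kind) := HilbertSpace {
  hilbert_sort :> completeNormedModType (scalar R k);
  inner : {dot hilbert_sort for sconj R k};
  norm_inner : forall x : hilbert_sort, `|x| ^+ 2 = inner x x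
}.

Section Operators.
Context {R : realType} {k : scalar_kind} {H : hilbertSpace R k}.

(* The library norm of a complex space takes its (real) values in R[i]. *)
Definition hnorm (x : H) : R := sre `|x|.

(* When H is the zero space the set below is empty and its sup is 0; for an
   unbounded operator the sup takes a default value. *)
Definition opnorm (A : H -> H) : R :=
  sup [set hnorm (A f) / hnorm f | f in [set f : H | f != 0]].

(* Boundedness need not be required: idempotence and self-adjointness give
   |P x|^2 = <P x, x> <= |P x| |x|. *)
Definition orthogonal_projection (P : {linear H -> H}) : Prop :=
  (forall x, P (P x) = P x) /\ (forall x y, inner H (P x) y = inner H x (P y)).

(* opprod P [:: i_1; ...; i_L] = P i_L \o ... \o P i_1 *)
Definition opprod (I : Type) (P : I -> {linear H -> H}) (i : seq I) : H -> H :=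
  foldl (fun A j => P j \o A) idfun i.

End Operators.

(* Positions are counted from 1, whereas index counts from 0. *)
Definition first_occ (T : eqType) (i : seq T) (j : T) : nat := (index j i).+1.

(* Main.v *)
Require Import Defs.
From HB Require Import structures.
From mathcomp Require Import all_boot all_order all_algebra sesquilinear.
From mathcomp Require Import complex.
From mathcomp Require Import all_classical all_reals all_analysis.
From mathcomp Require Import ring lra.
Set Implicit Arguments.
Unset Strict Implicit.
Unset Printing Implicit Defensive.
Import Order.TTheory GRing.Theory Num.Theory.
Import numFieldNormedType.Exports.
Local Open Scope ring_scope.

(** Put [S := \sum_j k_j] and [T := P_{i_L} ... P_{i_1}], fix [x], and write
    [x_m := P_{i_m} ... P_{i_1} x].  Each step removes the component orthogonal
    to the range of [P_{i_m}], so [|x_{m-1} - x_m|^2 = |x_{m-1}|^2 - |x_m|^2]: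
    the squared step lengths telescope to [|x|^2 - |x_m|^2], and Cauchy-Schwarz
    bounds the displacement, [|x - x_m|^2 <= m (|x|^2 - |x_m|^2)]
    ([hnorm2_displacement]).

    At time [m = k_j] the point [x_m] lies in the range of [P_j], and [P_j x] is
    the point of that range nearest to [x]; hence
    [|x - P_j x|^2 <= k_j (|x|^2 - |T x|^2)] ([hnorm2_defect_first_occ]).
    Summing over [j] gives [\sum_j |x - P_j x|^2 <= S (|x|^2 - |T x|^2)].

    On the other side, [\sum_j |x - P_j x|^2 = n |x|^2 - \sum_j <P_j x, x>], and
    the bound on the average of the projections makes this at least
    [n delta |x|^2] ([hnorm2_defect_sum]).  Comparing the two estimates,
    [|T x|^2 <= (1 - n delta / S) |x|^2], which for [delta >= 0] is stronger
    than the claim by the factor 8.  For [delta < 0] the claim follows from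
    [|T x| <= |x|]. *)

(** * Real parts of scalars *)

Section RealPart.
Variables (R : realType) (k : scalar_kind).
Implicit Types a b : Defs.scalar R k.

Lemma sre_is_zmod_morphism : zmod_morphism (@sre R k).
Proof. by case: k => // -[a b] [c d]. Qed.

HB.instance Definition _ :=
  GRing.isZmodMorphism.Build _ _ (@sre R k) sre_is_zmod_morphism.

Lemma le_sre a b : a <= b -> sre a <= sre b.
Proof. by case: k a b => //= a b; rewrite lecE => /andP[]. Qed.

Lemma sre_sconj a : sre (sconj R k a) = sre a.
Proof. by case: k a => //= -[]. Qed.

(** Nonnegative scalars are real, and real parts multiply on real scalars. *)
Lemma sreX2 a : 0 <= a -> sre (a ^+ 2) = sre a ^+ 2.
Proof.
case: k a => //= -[a b]; rewrite lecE /= => /andP[/eqP-> _].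
by rewrite !expr2 /= mulr0 subr0.
Qed.

Lemma sre_eq0 a : 0 <= a -> sre a = 0 -> a = 0.
Proof.
case: k a => //= -[a b]; rewrite lecE /= => /andP[/eqP-> _] ->.
by [].
Qed.

End RealPart.

(** * The real inner product *)

(** The real part of the inner product makes a real or complex Hilbert space a
    real inner product space with the same norm, and projections remain
    self-adjoint for it; the argument takes place there. *)
Definition rinner (R : realType) (k : scalar_kind) (H : hilbertSpace R k)
  (x y : H) : R := sre (inner H x y).

Section RealInner.
Variables (R : realType) (k : scalar_kind) (H : hilbertSpace R k).
Implicit Types x y z : H.

Lemma rinnerC x y : rinner x y = rinner y x.
Proof. by rewrite /rinner hermC expr0 mul1r sre_sconj. Qed.

Lemma rinnerBl x y z : rinner (x - y) z = rinner x z - rinner y z.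
Proof. by rewrite /rinner linearBl raddfB. Qed.

Lemma rinnerBr x y z : rinner x (y - z) = rinner x y - rinner x z.
Proof. by rewrite rinnerC rinnerBl !(rinnerC x). Qed.

Lemma rinnerMnl x y m : rinner (x *+ m) y = rinner x y *+ m.
Proof. by rewrite /rinner linearMnl raddfMn. Qed.

Lemma rinner_suml (I : Type) (r : seq I) (F : I -> H) y :
  rinner (\sum_(j <- r) F j) y = \sum_(j <- r) rinner (F j) y.
Proof. by rewrite /rinner linear_sumlz raddf_sum. Qed.

Lemma hnorm_ge0 x : 0 <= hnorm x.
Proof. by have := le_sre (normr_ge0 x); rewrite raddf0. Qed.

Lemma hnorm2 x : hnorm x ^+ 2 = rinner x x.
Proof. by rewrite /hnorm /rinner -norm_inner sreX2. Qed.

Lemma hnorm_eq0 x : hnorm x = 0 -> x = 0.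
Proof. by move/(sre_eq0 (normr_ge0 x))/normr0_eq0. Qed.

Lemma hnorm_gt0 x : x != 0 -> 0 < hnorm x.
Proof.
move=> x0; rewrite lt_neqAle hnorm_ge0 andbT eq_sym.
by apply: contra x0 => /eqP/hnorm_eq0/eqP.
Qed.

Lemma hnorm_triangle x y : hnorm (x + y) <= hnorm x + hnorm y.
Proof. by rewrite /hnorm -raddfD; exact/le_sre/ler_normD. Qed.

Lemma hnorm_sum (I : Type) (r : seq I) (F : I -> H) :
  hnorm (\sum_(j <- r) F j) <= \sum_(j <- r) hnorm (F j).
Proof. by rewrite /hnorm -raddf_sum; exact/le_sre/ler_norm_sum. Qed.

Lemma hnormMn x m : hnorm (x *+ m) = hnorm x *+ m.
Proof. by rewrite /hnorm normrMn raddfMn. Qed.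

Lemma hnorm_opp x : hnorm (- x) = hnorm x.
Proof. by rewrite /hnorm normrN. Qed.

Lemma hnorm2B x y :
  hnorm (x - y) ^+ 2 = hnorm x ^+ 2 - 2 * rinner x y + hnorm y ^+ 2.
Proof. by rewrite !hnorm2 rinnerBl !rinnerBr (rinnerC y); ring. Qed.

(** Cauchy-Schwarz follows from the triangle inequality, which belongs to the
    structure of a normed space: square [| |x| - |y| | <= |x - y|]. *)
Lemma rinner_le_hnorm x y : rinner x y <= hnorm x * hnorm y.
Proof.
have tri (u v : H) : hnorm u - hnorm v <= hnorm (u - v).
  by rewrite lerBlDr; have := hnorm_triangle (u - v) v; rewrite subrK.
have sqr : (hnorm x - hnorm y) ^+ 2 <= hnorm (x - y) ^+ 2.
  rewrite -real_normK ?num_real// ler_sqr ?nnegrE ?normr_ge0 ?hnorm_ge0//.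
  by rewrite ler_norml tri andbT lerNl opprB -(hnorm_opp (x - y)) opprB tri.
by move: sqr; rewrite hnorm2B sqrrB; lra.
Qed.

End RealInner.

(** * Orthogonal projections *)

Section Projection.
Variables (R : realType) (k : scalar_kind) (H : hilbertSpace R k).
Variables (P : {linear H -> H}) (hP : orthogonal_projection P).
Implicit Types x y : H.

Lemma rinner_proj x : rinner (P x) x = hnorm (P x) ^+ 2.
Proof. by case: hP => idP saP; rewrite hnorm2 /rinner -saP idP. Qed.

Lemma hnorm2_proj_defect x :
  hnorm (x - P x) ^+ 2 = hnorm x ^+ 2 - hnorm (P x) ^+ 2.
Proof. by rewrite hnorm2B rinnerC rinner_proj; ring. Qed.

Lemma hnorm_proj x : hnorm (P x) <= hnorm x.
Proof.
rewrite -ler_sqr ?nnegrE ?hnorm_ge0// -subr_ge0 -hnorm2_proj_defect.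
exact: sqr_ge0.
Qed.

(** [x - P x] is also the defect of [x - y] when [P] fixes [y]. *)
Lemma hnorm2_proj_nearest x y : P y = y ->
  hnorm (x - P x) ^+ 2 <= hnorm (x - y) ^+ 2.
Proof.
move=> Py; have -> : x - P x = (x - y) - P (x - y).
  by rewrite linearB /= Py opprB addrA subrK.
by rewrite hnorm2_proj_defect lerBlDr lerDl sqr_ge0.
Qed.

End Projection.

(** * Products of projections *)

(** The step from [m] to [m + 1] terms in the Cauchy-Schwarz bound of the square
    of a sum: [a] stands for the sum of the first [m] terms, [A] for the sum of
    their squares. *)
Lemma sqrD_le_natr (R : realFieldType) (m : nat) (a b A B : R) :
  0 <= A -> a ^+ 2 <= m%:R * A -> b ^+ 2 <= B ->
  (a + b) ^+ 2 <= m.+1%:R * (A + B).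
Proof.
move=> A0 aA bB; case: m => [|m] in aA *.
  have -> : a = 0 by apply/eqP; rewrite -sqrf_eq0 eq_le sqr_ge0 -(mul0r A) aA.
  by rewrite add0r mul1r; lra.
have M0 : 0 < m.+1%:R :> R by rewrite ltr0n.
rewrite -[m.+2%:R]natr1; move: (m.+1%:R) M0 aA => M M0 aA.
(* the cross term is bounded by [2 a b <= a^2 / M + M b^2], here multiplied
   by [M] *)
rewrite -(ler_pM2l M0).
have := sqr_ge0 (a - M * b).
have := ler_wpM2l (ltW M0) aA.
have := ler_wpM2l (mulr_ge0 (ltW M0) (addr_ge0 (ltW M0) ler01)) bB.
lra.
Qed.

Section Product.
Variables (R : realType) (k : scalar_kind) (H : hilbertSpace R k).
Variables (I : eqType) (P : I -> {linear H -> H}).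
Hypothesis hP : forall j, orthogonal_projection (P j).
Implicit Types (s t : seq I) (x : H).

Lemma opprod_rcons s j x : opprod P (rcons s j) x = P j (opprod P s x).
Proof. by rewrite /opprod foldl_rcons. Qed.

Lemma hnorm_opprod_cat s t x :
  hnorm (opprod P (s ++ t) x) <= hnorm (opprod P s x).
Proof.
elim/last_ind: t => [|t j IHt]; first by rewrite cats0.
by rewrite -rcons_cat opprod_rcons (le_trans (hnorm_proj (hP j) _)).
Qed.

Lemma hnorm_opprod s x : hnorm (opprod P s x) <= hnorm x.
Proof. exact: (hnorm_opprod_cat [::]). Qed.

(** The squared step lengths telescope to the loss of squared norm, and the
    displacement is at most the sum of the [size s] step lengths. *)
Lemma hnorm2_displacement s x :
  hnorm (x - opprod P s x) ^+ 2 <=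
    (size s)%:R * (hnorm x ^+ 2 - hnorm (opprod P s x) ^+ 2).
Proof.
elim/last_ind: s => [|s j IHs].
  by rewrite /= subrr hnorm2 -(subrr x) rinnerBl !subrr mul0r.
rewrite opprod_rcons size_rcons; set y := opprod P s x in IHs *.
have tri : hnorm (x - P j y) <= hnorm (x - y) + hnorm (y - P j y).
  by have := hnorm_triangle (x - y) (y - P j y); rewrite addrA subrK.
apply: (@le_trans _ _ ((hnorm (x - y) + hnorm (y - P j y)) ^+ 2)).
  by rewrite ler_sqr ?nnegrE ?addr_ge0 ?hnorm_ge0.
have -> : hnorm x ^+ 2 - hnorm (P j y) ^+ 2 =
    (hnorm x ^+ 2 - hnorm y ^+ 2) + (hnorm y ^+ 2 - hnorm (P j y) ^+ 2) by ring.
apply: sqrD_le_natr => //; last by rewrite (hnorm2_proj_defect (hP j)).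
by rewrite subr_ge0 ler_sqr ?nnegrE ?hnorm_ge0// hnorm_opprod.
Qed.

(** The partial product that ends with the first factor [P j] takes its values
    in the range of [P j], so the distance from [x] to that range is at most
    the displacement by that time; the norm only decreases afterwards. *)
Lemma hnorm2_defect_first_occ s j x : j \in s ->
  hnorm (x - P j x) ^+ 2 <=
    (first_occ s j)%:R * (hnorm x ^+ 2 - hnorm (opprod P s x) ^+ 2).
Proof.
move=> js; set m := first_occ s j.
have lt_js : (index j s < size s)%N by rewrite index_mem.
have fixed : P j (opprod P (take m s) x) = opprod P (take m s) x.
  rewrite /m /first_occ (take_nth j lt_js) nth_index// opprod_rcons.
  by case: (hP j).
apply: le_trans (hnorm2_proj_nearest (hP j) _ fixed) _.
apply: le_trans (hnorm2_displacement _ _) _.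
rewrite size_takel// ler_wpM2l ?ler0n// lerB//.
rewrite ler_sqr ?nnegrE ?hnorm_ge0// -{1}(cat_take_drop m s).
exact: hnorm_opprod_cat.
Qed.

End Product.

(** * Operator norms *)

Section OperatorNorm.
Local Open Scope classical_set_scope.
Variables (R : realType) (k : scalar_kind) (H : hilbertSpace R k).
Variable (A : H -> H).

Lemma opnorm_ge0 : 0 <= opnorm A.
Proof.
rewrite /opnorm; set E := [set _ | _ in _].
have [[[r Er] ubE]|/sup_out->//] := pselect (has_sup E).
apply: le_trans (ub_le_sup ubE Er).
by case: Er => f _ <-; rewrite divr_ge0 ?hnorm_ge0.
Qed.

Lemma opnorm_le (M : R) : 0 <= M ->
  (forall f, hnorm (A f) <= M * hnorm f) -> opnorm A <= M.
Proof.
move=> M0 AM; rewrite /opnorm; set E := [set _ | _ in _].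
have [supE|/sup_out->//] := pselect (has_sup E).
apply: ge_sup; first by case: supE.
by move=> _ [f /= f0 <-]; rewrite ler_pdivrMr ?hnorm_gt0.
Qed.

(** The bound [M] ensures that the supremum is not a default value. *)
Lemma hnorm_le_opnorm (M : R) (f : H) :
  (forall g, hnorm (A g) <= M * hnorm g) -> f != 0 ->
  hnorm (A f) <= opnorm A * hnorm f.
Proof.
move=> AM f0; rewrite -ler_pdivrMr ?hnorm_gt0//.
apply: ub_le_sup; last by exists f.
by exists M => _ [g /= g0 <-]; rewrite ler_pdivrMr ?hnorm_gt0.
Qed.

End OperatorNorm.

(** * The average of the projections *)

Section Average.
Variables (R : realType) (k : scalar_kind) (H : hilbertSpace R k).
Variables (n : nat) (P : 'I_n -> {linear H -> H}).
Hypothesis hP : forall j, orthogonal_projection (P j).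

Let avg (f : H) : H := n%:R^-1 *: \sum_(j < n) P j f.

Lemma avgMn (f : H) : (0 < n)%N -> avg f *+ n = \sum_(j < n) P j f.
Proof.
by move=> n0; rewrite -scaler_nat scalerA divff ?scale1r// pnatr_eq0 -lt0n.
Qed.

Lemma hnorm2_defect_sum (delta : R) (x : H) : (0 < n)%N ->
  opnorm avg <= 1 - delta ->
  n%:R * delta * hnorm x ^+ 2 <= \sum_(j < n) hnorm (x - P j x) ^+ 2.
Proof.
move=> n0 avg_le.
have [->|x0] := eqVneq x 0.
  rewrite hnorm2 /rinner linear0l raddf0 mulr0 sumr_ge0// => j _.
  exact: sqr_ge0.
have nR0 : 0 < n%:R :> R by rewrite ltr0n.
have bounded f : hnorm (avg f) <= 1 * hnorm f.
  rewrite mul1r -(ler_pMn2r n0) -hnormMn avgMn//.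
  apply: le_trans (hnorm_sum _ _) _.
  rewrite -[in leRHS](card_ord n) -sumr_const.
  by apply: ler_sum => j _; exact: hnorm_proj.
have avgx : hnorm (avg x) <= (1 - delta) * hnorm x.
  by apply: le_trans (hnorm_le_opnorm bounded x0) _; rewrite ler_wpM2r ?hnorm_ge0.
have sumE : \sum_(j < n) hnorm (x - P j x) ^+ 2 =
    n%:R * (hnorm x ^+ 2 - rinner (avg x) x).
  rewrite mulrBr !mulr_natl -rinnerMnl avgMn// rinner_suml.
  rewrite -[in X in _ *+ X](card_ord n) -sumr_const -sumrB; apply: eq_bigr => j _.
  by rewrite (hnorm2_proj_defect (hP j)) (rinner_proj (hP j)).
rewrite sumE -mulrA ler_pM2l//.
have := rinner_le_hnorm (avg x) x.
have := ler_wpM2r (hnorm_ge0 x) avgx.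
by rewrite -mulrA -expr2; lra.
Qed.

End Average.

(** * The bound for the product *)

Theorem theorem1p3 (R : realType) (k : scalar_kind) (H : hilbertSpace R k)
    (n : nat) (hn : (1 <= n)%N) (delta : R) (P : 'I_n -> {linear H -> H})
    (hP : forall j, orthogonal_projection (P j))
    (hdelta :
       opnorm (fun f : H => n%:R^-1 *: \sum_(j < n) P j f) <= 1 - delta)
    (L : nat) (i : L.-tuple 'I_n)
    (hall : forall j, j \in i)
    (hfirst : forall j : 'I_n, j = 0%N :> nat -> first_occ i j = 1%N)
    (hmono : forall j1 j2 : 'I_n,
       (j1 <= j2)%N -> (first_occ i j1 <= first_occ i j2)%N)
    (hlast : forall j : 'I_n, j.+1 = n -> first_occ i j = L) :
  opnorm (opprod P i) ^+ 2 <=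
    1 - n%:R * delta / (8 * (\sum_(j < n) first_occ i j)%:R).
Proof.
set S : nat := (\sum_(j < n) first_occ i j)%N.
have leSn : (n <= S)%N.
  by rewrite -[X in (X <= _)%N]card_ord -sum1_card leq_sum.
have n0 : 0 < n%:R :> R by rewrite ltr0n.
have S_ge : n%:R <= S%:R :> R by rewrite ler_nat.
(* this makes the right-hand side nonnegative even when [H] is zero *)
have delta_le1 : delta <= 1.
  by rewrite -subr_ge0; exact: le_trans (opnorm_ge0 _) hdelta.
set c := 1 - _.
have cE : c * S%:R = S%:R - n%:R * delta / 8.
  by rewrite /c; field; lra.
have S0 : 0 < S%:R :> R by lra.
have c0 : 0 <= c by rewrite -(pmulr_lge0 _ S0) cE; nra.
have contract f : hnorm (opprod P i f) ^+ 2 <= c * hnorm f ^+ 2.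
  have lower := hnorm2_defect_sum hP f hn hdelta.
  have upper : \sum_(j < n) hnorm (f - P j f) ^+ 2 <=
      S%:R * (hnorm f ^+ 2 - hnorm (opprod P i f) ^+ 2).
    rewrite natr_sum mulr_suml; apply: ler_sum => j _.
    exact: hnorm2_defect_first_occ.
  have nonexp : hnorm (opprod P i f) ^+ 2 <= hnorm f ^+ 2.
    by rewrite ler_sqr ?nnegrE ?hnorm_ge0// hnorm_opprod.
  rewrite -(ler_pM2l S0) [leRHS]mulrA [_ * c]mulrC cE.
  have := sqr_ge0 (hnorm f).
  move: (hnorm f ^+ 2) (hnorm (opprod P i f) ^+ 2) lower upper nonexp => X Y.
  move=> lower upper nonexp X0.
  have [d0|d0] := leP 0 delta.
    have : 0 <= n%:R * delta * X by rewrite !mulr_ge0 // ltW.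
    lra.
  have : 0 <= n%:R * (- delta) * X by rewrite !mulr_ge0 // ?oppr_ge0 ltW.
  have := ler_wpM2l (ltW S0) nonexp.
  lra.
rewrite -[leRHS](sqr_sqrtr c0) ler_sqr ?nnegrE ?opnorm_ge0 ?sqrtr_ge0//.
apply: opnorm_le => [|f]; first exact: sqrtr_ge0.
rewrite -ler_sqr ?nnegrE ?mulr_ge0 ?hnorm_ge0 ?sqrtr_ge0//.
by rewrite exprMn sqr_sqrtr.
Qed.
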